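(* Suppose $K, L, r, c < \omega$ are given. Then there are $K_*, L_* < \omega$ such that whenever $n \geq K_* \cdot L_*$, and whenever $E$ is an equivalence relation on $n=\{0,\ldots,n-1\}$ with at least $K_*$ many classes, of size at least $L_*$, and whenever $f: \binom{n}{r} \to c$, there is some $X \subseteq n$ which is $E$-homogeneous for $f$ and such that $E \restriction_X$ has at least $K$ many classes, each convex in $X$ and of size at least $L$.
   Context: A natural number $n$ is identified with $\{0,\ldots,n-1\}$. For a set $X$ of natural numbers, $\binom{X}{r}$ is the set of $r$-element subsets of $X$; each $s \in \binom{X}{r}$ is identified with its increasing enumeration $s(0) < \cdots < s(r-1)$. Given an equivalence relation $E$ on $n$ and $f: \binom{n}{r} \to c$, a set $X \subseteq n$ is $E$-homogeneous for $f$ if for all $s,t \in \binom{X}{r}$: if for all $i,j<r$ we have $s(i)\,E\,s(j)$ iff $t(i)\,E\,t(j)$, then $f(s) = f(t)$. Given $B \subseteq Y \subseteq n$, $B$ is convex in $Y$ if whenever $n_0 < n_1 < n_2 < n$ with $n_0, n_2 \in B$ and $n_1 \in Y$, then $n_1 \in B$. $E\restriction_X$ is the restriction of $E$ to $X$. *)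

(* Defs.v *)
From mathcomp Require Import all_boot.

Set Implicit Arguments.
Unset Strict Implicit.
Unset Printing Implicit Defensive.

Definition rsubset (n r : nat) := {s : {set 'I_n} | #|s| == r}.

(* s(i): enum_val lists the elements of a {set 'I_n} in increasing order, as  *)
(* the two lemmas below confirm.                                              *)
Definition elt (n r : nat) (s : rsubset n r) (i : 'I_r) : 'I_n :=
  enum_val (cast_ord (esym (eqP (valP s))) i).

Lemma elt_ltn (n r : nat) (s : rsubset n r) (i j : 'I_r) :
  i < j -> elt s i < elt s j.
Proof.
move=> ij; rewrite /elt.
have srt : sorted ltn (map val (enum (val s))).
  rewrite {1}/enum_mem -enumT; apply: (subseq_sorted ltn_trans _ (iota_ltn_sorted 0 n)).
  by rewrite -val_enum_ord; apply: map_subseq; apply: filter_subseq.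
have szi (k : 'I_r) : k < size (enum (val s)).
  by rewrite -cardE (eqP (valP s)).
have szm (k : 'I_r) : k < size (map val (enum (val s))) by rewrite size_map.
rewrite !(enum_val_nth (elt s i)).
have := sorted_ltn_nth ltn_trans 0 srt i j (szm i) (szm j) ij.
by rewrite !(nth_map (elt s i)).
Qed.

Lemma mem_elt (n r : nat) (s : rsubset n r) (x : 'I_n) :
  reflect (exists i, elt s i = x) (x \in val s).
Proof.
apply: (iffP idP) => [xs | [i <-]]; last exact: enum_valP.
exists (cast_ord (eqP (valP s)) (enum_rank_in xs x)).
by rewrite /elt cast_ordK enum_rankK_in.
Qed.

Definition E_homogeneous (n r c : nat) (E : rel 'I_n) (f : rsubset n r -> 'I_c)
    (X : {set 'I_n}) : Prop :=
  forall s t : rsubset n r, val s \subset X -> val t \subset X ->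
    (forall i j : 'I_r, E (elt s i) (elt s j) <-> E (elt t i) (elt t j)) ->
    f s = f t.

Definition convex_in (n : nat) (B Y : {set 'I_n}) : Prop :=
  forall n0 n1 n2 : 'I_n, n0 < n1 -> n1 < n2 ->
    n0 \in B -> n2 \in B -> n1 \in Y -> n1 \in B.

(* Main.v *)
Require Import Defs.
From mathcomp Require Import all_boot zify.

Set Implicit Arguments.
Unset Strict Implicit.
Unset Printing Implicit Defensive.

(** The idea is to colour a grid of points by coordinates and to apply the
    ordinary finite Ramsey theorem only once.

    A greedy choice ([increasing_blocks]) extracts from many large classes a
    grid of points [x i j] ([i, j < N]) in which row [i] lies in one class,
    different rows lie in different classes, and the points increase
    lexicographically in [(i, j)].  An [r]-set of grid points has at most [2r]
    coordinates.  So colour a [2r]-set [A] of numbers by the table that gives,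
    for each way of building [r] grid points from coordinates in [A], the colour
    of the resulting [r]-set ([tuple_color]).  The number of possible tables
    depends on [r] and [c] only, so [ramsey] yields a long increasing sequence
    [h] all of whose [2r]-subsequences have the same table.

    Inside the grid over [h], the colour of an [r]-set can depend only on the
    relative order of all its row and column coordinates.  It remains to choose
    points for which the pattern of [E] determines this order.  For [L > 0] and
    [m = K * L], take the points
      [z a = x (h_(L * (a %/ L))) (h_(m + a))]   for [a < m].
    All row coordinates come before all column coordinates, the column
    coordinates increase with [a], and two points share their row exactly when
    they are equivalent.  Hence [a |-> z a] is increasing, its image consists of
    [K] consecutive blocks of [L] equivalent points
    ([partition_block_image]), and the colour of an [r]-set of these points is
    determined by its pattern ([homogeneous_of_tuple_color]). *)

(** * The finite Ramsey theorem *)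

(** The statement has a separate target length [m t] for each colour [t], so
    that a second induction, on the sum of these targets, does the work usually
    split between end-homogeneous sets and the pigeonhole principle: set aside
    the first element [x], make the colour of [x :: s] constant, say [t], on a
    long subsequence, and look there for a solution with the target of [t]
    lowered by one.  If it comes out with colour [t], then [x] can be put back
    in front.  The bound depends on the sum of the targets only, which spares
    a choice over all target functions. *)
Lemma ramsey (A : eqType) (T : finType) (d M : nat) :
  exists N, forall m : T -> nat, \sum_t m t <= M ->
  forall (col : seq A -> T) (w : seq A), N <= size w ->
  exists t h, [/\ subseq h w, m t <= size h &
    forall s, subseq s h -> size s = d -> col s = t].
Proof.
elim: d M => [|d IHd] M.
  exists M => m mM col w Mw; exists (col [::]), w; split=> //.
    by apply: leq_trans Mw; apply: leq_trans mM; rewrite (bigD1 (col [::])) ?leq_addr.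
  by move=> s _ /size0nil->.
elim: M => [|M [N HN]].
  exists 0 => m; rewrite leqn0 sum_nat_eq0 => /forallP m0 col w _.
  exists (col [::]), [::]; rewrite sub0seq; split=> //.
    by rewrite (eqP (m0 _)).
  by move=> s; rewrite subseq0 => /eqP->.
have [N1 HN1] := IHd (#|T| * N).
exists N1.+1 => m mM col [//|x w] N1w.
case: (pickP (fun t => m t == 0)) => [t /eqP mt0|m_gt0].
  exists t, [::]; rewrite sub0seq mt0; split=> //.
  by move=> s; rewrite subseq0 => /eqP->.
have [||t [h1 [h1w Nh1 colh1]]] := HN1 (fun=> N) _ (fun s => col (x :: s)) w.
- by rewrite sum_nat_const.
- exact: N1w.
have [||t2 [h2 [h2h1 mh2 colh2]]] := HN (fun u => m u - (u == t)) _ col h1.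
- rewrite -ltnS; apply: leq_trans mM.
  rewrite (bigD1 t) //= [X in _ < X](bigD1 t) //= eqxx.
  have := m_gt0 t; case: (m t) => //= mt _; rewrite subn1 /= addSn ltnS leq_add2l.
  by apply: leq_sum => u _; rewrite leq_subr.
- exact: Nh1.
have h2w := subseq_trans h2h1 h1w.
case: (eqVneq t2 t) mh2 colh2 => [->|_] mh2 colh2; last first.
  exists t2, h2; split=> //; last by rewrite -[m t2]subn0.
  exact: subseq_trans h2w (subseq_cons _ _).
exists t, (x :: h2); split; first by rewrite /= eqxx.
  by move: mh2 => /=; lia.
case=> [//|y s] /=; case: eqP => [-> sh2 [sd]|_ sh2 sd]; last exact: colh2.
by apply: colh1 => //; apply: subseq_trans h2h1.
Qed.

(** * Increasing blocks in large sets *)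

(** Cut at the least [p] such that some [C0] in [P] has at least [l] points [y]
    with [q <= y < p].  These points of [C0] provide the first block; by
    minimality every member of [P] has at most [l] points between [q] and the
    cut, so that the others keep enough points above it for the remaining
    blocks. *)
Lemma increasing_blocks (n l : nat) (x0 : 'I_n) (k q : nat)
    (P : {set {set 'I_n}}) :
  k <= #|P| ->
  (forall C, C \in P -> k * l <= #|[set y in C | q <= y]|) ->
  exists (C : nat -> {set 'I_n}) (x : nat -> nat -> 'I_n),
  [/\ forall i, i < k -> C i \in P,
      forall i i', i < k -> i' < k -> C i = C i' -> i = i',
      forall i j, i < k -> j < l -> (x i j \in C i) && (q <= x i j),
      forall i j j', i < k -> j < j' -> j' < l -> x i j < x i j' &
      forall i i' j j', i < i' -> i' < k -> j < l -> j' < l ->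
        x i j < x i' j'].
Proof.
elim: k q P => [|k IHk] q P kP Pl.
  by exists (fun=> set0), (fun _ _ => x0); split=> // i i' j j' _ //; lia.
pose S (C : {set 'I_n}) (p : nat) := [set y in C | q <= y < p].
have exp : exists p, [exists C in P, l <= #|S C p|].
  have /card_gt0P[C CP] : 0 < #|P| by exact: leq_trans kP.
  exists n; apply/exists_inP; exists C => //.
  apply: leq_trans (leq_trans (Pl C CP) _); first by rewrite mulSn leq_addr.
  by apply: subset_leq_card; apply/subsetP => y; rewrite !inE ltn_ord andbT.
case: (ex_minnP exp) => p /exists_inP[C0 C0P lC0] pmin.
(* Below [p - 1] each member has fewer than [l] points, and raising the cut
   by one adds at most one point. *)
have Sp C : C \in P -> #|S C p| <= l.
  case: p {C0 C0P lC0} pmin => [|p] pmin CP.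
    by rewrite (_ : S C 0 = set0) ?cards0 //; apply/setP=> y; rewrite !inE !andbF.
  have ltl : #|S C p| < l.
    rewrite ltnNge; apply/negP => lS.
    suff /pmin : [exists C in P, l <= #|S C p|] by rewrite ltnn.
    by apply/exists_inP; exists C.
  apply: leq_trans ltl.
  have : S C p.+1 \subset S C p :|: [set y : 'I_n | y == p :> nat].
    by apply/subsetP => y; rewrite !inE; lia.
  move/subset_leq_card/leq_trans; apply.
  apply: leq_trans (leq_card_setU _ _) _.
  rewrite -[X in _ <= X]addn1 leq_add2l.
  apply/card_le1_eqP => u v; rewrite !inE => /eqP up /eqP vp.
  by apply: val_inj; rewrite /= up vp.
have [||C [x [CP Cinj xC xrow xlex]]] := IHk p (P :\ C0).
- by move: kP; rewrite (cardsD1 C0 P) C0P.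
- move=> C; rewrite inE => /andP[_ CP].
  have : [set y in C | q <= y] \subset S C p :|: [set y in C | p <= y].
    by apply/subsetP => y; rewrite !inE; lia.
  move/subset_leq_card => le1.
  have := leq_trans (leq_trans (Pl C CP) le1) (leq_card_setU _ _).
  by have := Sp C CP; rewrite mulSn; lia.
pose s : rsubset n #|S C0 p| := exist _ (S C0 p) (eqxx _).
pose b j := odflt x0 (omap (elt s) (insub j)).
have bE j (lj : j < #|S C0 p|) : b j = elt s (Ordinal lj) by rewrite /b insubT.
have bS j : j < l -> b j \in S C0 p.
  move=> jl; rewrite (bE j (leq_trans jl lC0)).
  exact: (introT (mem_elt s _) (ex_intro _ _ erefl)).
exists (fun i => if i is i'.+1 then C i' else C0).
exists (fun i => if i is i'.+1 then x i' else b).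
have C0C i : i < k -> C i <> C0.
  by move=> ik CiC0; have := CP i ik; rewrite CiC0 !inE eqxx.
split.
- by case=> [//|i] ik; have := CP i ik; rewrite inE => /andP[].
- case=> [|i] [|i'] //= ik ik' eqC.
  + by case: (C0C i').
  + by case: (C0C i).
  + by rewrite (Cinj i i').
- case=> [|i] j ik jl.
    by have := bS j jl; rewrite !inE; lia.
  by have := bS j jl; have := xC i j ik jl; rewrite !inE; lia.
- case=> [|i] j j' ik jj' j'l; last exact: xrow.
  by rewrite (bE j' (leq_trans j'l lC0)) (bE j (ltn_trans jj' (leq_trans j'l lC0))) elt_ltn.
- case=> [|i] [|i'] j j' // ii' ik jl j'l; last exact: xlex.
  by have := bS j jl; have := xC i' j' ik j'l; rewrite !inE; lia.
Qed.

(** * Colour tables and addresses of sets of grid points *)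

Lemma subseq_map_nth (h U : seq nat) :
  sorted ltn U -> all (gtn (size h)) U -> subseq [seq nth 0 h i | i <- U] h.
Proof.
move=> sU Uh; rewrite -[X in subseq _ X](mkseq_nth 0) /mkseq.
apply: map_subseq.
rewrite (_ : U = [seq i <- iota 0 (size h) | i \in U]) ?filter_subseq //.
apply: (irr_sorted_eq ltn_trans ltnn) => //.
  by rewrite sorted_filter ?iota_ltn_sorted //; exact: ltn_trans.
move=> i; rewrite mem_filter mem_iota add0n /=.
by case: (boolP (i \in U)) => // /(allP Uh) /= ->.
Qed.

(** The entry at [phi] is the colour of the set of the [r] grid points whose
    rows are taken, as prescribed by [phi], among the first [r] elements of [A]
    and whose columns are the last [r] elements of [A], in order.  The entry is
    [None] when these points are not distinct. *)
Definition tuple_color (n r c : nat) (x : nat -> nat -> 'I_n)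
    (f : rsubset n r -> 'I_c) (A : seq nat) :
    {ffun {ffun 'I_r -> 'I_r} -> option 'I_c} :=
  [ffun phi : {ffun 'I_r -> 'I_r} => omap f
    (insub [set x (nth 0 A (phi i)) (nth 0 A (r + i)) | i : 'I_r])].

(** Cut ['I_m] into intervals of length [L]; then [phi i] is the least index
    whose value under [a] lies in the same interval as that of [i].  This is
    expressed through equality of intervals alone, so that it holds as well for
    any other [a] with the same pattern. *)
Definition block_leader (r m L : nat) (a : 'I_r -> 'I_m) (phi : 'I_r -> 'I_r) :=
  forall i j, (a (phi i) %/ L = a i %/ L) /\
    (a j %/ L = a i %/ L -> phi i <= j).

(** The positions in [h] of the coordinates of the points [z (a j)], with
    exactly [r + r] entries however many rows occur.  The least index [j] in each row
    stands for the row coordinate; each other index contributes [a j], a filler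
    that no point uses but that falls strictly between the row coordinates of
    its own row and of the next one. *)
Definition address (r m L : nat) (a : 'I_r -> 'I_m) (phi : 'I_r -> 'I_r) :
    seq nat :=
  [seq if phi j == j then a j %/ L * L else a j | j <- enum 'I_r]
  ++ [seq m + a j | j <- enum 'I_r].

Lemma size_address (r m L : nat) (a : 'I_r -> 'I_m) (phi : 'I_r -> 'I_r) :
  size (address L a phi) = r + r.
Proof. by rewrite size_cat 2!size_map size_enum_ord. Qed.

Lemma address_bound (r m L : nat) (a : 'I_r -> 'I_m) (phi : 'I_r -> 'I_r) :
  all (gtn (m + m)) (address L a phi).
Proof.
rewrite all_cat !all_map; apply/andP; split; apply/allP => j _ /=.
  by have := ltn_ord (a j); have := leq_divM (a j) L; case: ifP; lia.
by rewrite ltn_add2l.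
Qed.

(** The entry at [j] of the first half is at most [a j], and it exceeds [a i]
    for all [i < j]: if [j] is a leader, then it starts an interval which [a i]
    has not reached. *)
Lemma sorted_address (r m L : nat) (a : 'I_r -> 'I_m) (phi : 'I_r -> 'I_r) :
  (forall i j : 'I_r, i < j -> a i < a j) -> block_leader L a phi ->
  sorted ltn (address L a phi).
Proof.
move=> a_lt lead.
have sub (u : 'I_r -> nat) : (forall i j : 'I_r, i < j -> u i < u j) ->
    pairwise ltn [seq u j | j <- enum 'I_r].
  move=> u_lt; rewrite pairwise_map.
  apply: (@sub_pairwise _ (relpre val ltn)) => //.
  by rewrite -pairwise_map val_enum_ord -(sorted_pairwise ltn_trans) iota_ltn_sorted.
rewrite (sorted_pairwise ltn_trans) pairwise_cat; apply/and3P; split.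
- apply/allrelP => _ _ /mapP[i _ ->] /mapP[j _ ->].
  by have := ltn_ord (a i); have := leq_divM (a i) L; case: ifP; lia.
- apply: sub => i j ij; have aij := a_lt i j ij.
  have lei : (if phi i == i then a i %/ L * L else a i) <= a i.
    by case: ifP => // _; exact: leq_divM.
  apply: leq_ltn_trans lei _; case: eqP => [phij|_]; last exact: aij.
  have neq : a i %/ L != a j %/ L.
    by apply/eqP => /((lead j i).2); rewrite phij leqNgt ij.
  have L0 : 0 < L by case: (L) neq; rewrite ?divn0.
  rewrite -ltn_divLR // ltn_neqAle neq /=.
  by apply: leq_div2r; apply: ltnW.
- by apply: sub => i j /a_lt; rewrite ltn_add2l.
Qed.

Lemma nth_map_enum_ord (r : nat) (u : 'I_r -> nat) (i : 'I_r) :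
  nth 0 [seq u j | j <- enum 'I_r] i = u i.
Proof. by rewrite (nth_map i) ?size_enum_ord // nth_ord_enum. Qed.

(** Read along its own leader function, the table of the address of [s] shows
    the colour of [s] itself. *)
Lemma tuple_color_address (n r c m L : nat) (x : nat -> nat -> 'I_n)
    (f : rsubset n r -> 'I_c) (h : seq nat) (s : rsubset n r)
    (a : 'I_r -> 'I_m) (phi : {ffun 'I_r -> 'I_r}) :
  block_leader L a phi ->
  (forall i, elt s i = x (nth 0 h (a i %/ L * L)) (nth 0 h (m + a i))) ->
  tuple_color x f [seq nth 0 h i | i <- address L a phi] phi = Some (f s).
Proof.
move=> lead sE; rewrite ffunE (_ : [set _ | _ in _] = val s) ?valK //.
(* A leader leads itself, so the entry at [phi i] is the row coordinate. *)
have phiK i : phi (phi i) = phi i.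
  apply/val_inj/eqP; rewrite eqn_leq (lead (phi i) (phi i)).2 //=.
  by apply: (lead i _).2; rewrite !(lead _ i).1.
have szA (i : 'I_r) : i < r + r by rewrite ltn_addr.
apply/setP => y; apply/imsetP/(mem_elt s) => [[i _ ->]|[i <-]]; exists i => //;
  rewrite sE !(nth_map 0) ?size_address ?ltn_add2l //;
  rewrite !nth_cat size_map size_enum_ord ltn_ord ltnNge leq_addr /= addKn;
  by rewrite !nth_map_enum_ord phiK eqxx (lead i i).1.
Qed.

Lemma exists_block_leader (r m L : nat) (a : 'I_r -> 'I_m) :
  exists phi : {ffun 'I_r -> 'I_r}, block_leader L a phi.
Proof.
exists [ffun i => [arg min_(j < i | a j %/ L == a i %/ L) j]] => i j.
rewrite ffunE; case: arg_minnP => // k /eqP ak kmin.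
by split=> // aj; apply: kmin; apply/eqP.
Qed.

(** * Classes and homogeneity of the chosen points *)

Lemma partition_block_image (n K L : nat) (E : rel 'I_n) (z : 'I_(K * L) -> 'I_n) :
  0 < L ->
  (forall a b : 'I_(K * L), a < b -> z a < z b) ->
  (forall a b, E (z a) (z b) = (a %/ L == b %/ L)) ->
  let X := [set z a | a : 'I_(K * L)] in
  K <= #|equivalence_partition E X| /\
  forall C : {set 'I_n}, C \in equivalence_partition E X ->
    convex_in C X /\ L <= #|C|.
Proof.
move=> L0 z_lt zE X.
have ord (i : 'I_K) (j : 'I_L) : i * L + j < K * L.
  by have := ltn_ord i; have := ltn_ord j; nia.
pose g i j := Ordinal (ord i j).
have gdiv i j : g i j %/ L = i by rewrite /= divnMDl // divn_small ?addn0.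
have zX a : z a \in X by apply: imset_f.
have z_ltE a b : (z a < z b) = (a < b).
  case: (ltngtP a b) => [/z_lt->//|/z_lt ba|/val_inj->]; last by rewrite ltnn.
  by apply/negbTE; rewrite -leqNgt ltnW.
have z_inj : injective z.
  move=> a b zab; apply/val_inj/eqP.
  by rewrite /= eqn_leq leqNgt -z_ltE zab ltnn leqNgt -z_ltE zab ltnn.
pose cls a := [set y in X | E (z a) y].
have mem_cls a b : (z b \in cls a) = (a %/ L == b %/ L).
  by rewrite inE zX zE.
split.
  pose G (i : 'I_K) := cls (g i (Ordinal L0)).
  have Ginj : injective G.
    move=> i i' /setP/(_ (z (g i (Ordinal L0)))).
    by rewrite !mem_cls !gdiv eqxx => /esym/eqP/val_inj->.
  rewrite -[X in X <= _]card_ord -cardsT -(card_imset _ Ginj).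
  apply: subset_leq_card; apply/subsetP => _ /imsetP[i _ ->].
  by apply: imset_f; apply: zX.
move=> _ /imsetP[_ /imsetP[a _ ->] ->]; rewrite -/(cls a); split.
  move=> n0 n1 n2 lt01 lt12 /[dup] + + /[dup] + + /imsetP[a1 _ n1E].
  rewrite {1}inE => /andP[/imsetP[a0 _ n0E] _].
  move=> n0C; rewrite {1}inE => /andP[/imsetP[a2 _ n2E] _] n2C.
  move: lt01 lt12 n0C n2C; rewrite n0E n1E n2E !z_ltE !mem_cls.
  move=> lt01 lt12 /eqP e0 /eqP e2; rewrite eqn_leq {1}e0 e2.
  by rewrite !leq_div2r // ltnW.
have aK : a %/ L < K by rewrite ltn_divLR.
have ginj : injective (fun j => z (g (Ordinal aK) j)).
  by move=> j j' /z_inj /(congr1 val) /= /addnI /val_inj.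
rewrite -[X in X <= _]card_ord -cardsT -(card_imset _ ginj).
apply: subset_leq_card; apply/subsetP => _ /imsetP[j _ ->].
by rewrite mem_cls gdiv.
Qed.

(** Two sets with the same pattern have a common leader function [phi].  Their
    addresses may differ, but both give [r + r]-element subsequences of [h],
    hence the same table, whose entry at [phi] is the colour of either set. *)
Lemma homogeneous_of_tuple_color (n r c m L : nat) (E : rel 'I_n)
    (x : nat -> nat -> 'I_n) (f : rsubset n r -> 'I_c) (h : seq nat)
    (t0 : {ffun {ffun 'I_r -> 'I_r} -> option 'I_c}) :
  m + m <= size h ->
  (forall A, subseq A h -> size A = r + r -> tuple_color x f A = t0) ->
  let z (a : 'I_m) := x (nth 0 h (a %/ L * L)) (nth 0 h (m + a)) in
  (forall a b : 'I_m, a < b -> z a < z b) ->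
  (forall a b, E (z a) (z b) = (a %/ L == b %/ L)) ->
  E_homogeneous E f [set z a | a : 'I_m].
Proof.
move=> mh hom z z_lt zE.
have lift (s : rsubset n r) : val s \subset [set z a | a : 'I_m] ->
    exists a : 'I_r -> 'I_m, forall i, elt s i = z (a i).
  move=> /subsetP sX; apply: (@fin_all_exists _ _ (fun i b => elt s i = z b)) => i.
  have /sX/imsetP[a _ ->] : elt s i \in val s by apply/mem_elt; exists i.
  by exists a.
have lift_lt (s : rsubset n r) a : (forall i, elt s i = z (a i)) ->
    forall i j : 'I_r, i < j -> a i < a j.
  move=> sa i j /(elt_ltn s); rewrite !sa ltnNge; apply: contraNT.
  by rewrite -leqNgt leq_eqVlt => /orP[/eqP/val_inj->//|/z_lt/ltnW].
move=> s t /lift[a sa] /lift[b tb] st.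
have abL i j : (a i %/ L == a j %/ L) = (b i %/ L == b j %/ L).
  by rewrite -!zE -!sa -!tb; apply/idP/idP => [/st|/(st i j)].
have [phi leada] := exists_block_leader L a.
have leadb : block_leader L b phi.
  move=> i j; split; first by apply/eqP; rewrite -abL (leada i j).1.
  by move/eqP; rewrite -abL => /eqP; apply: (leada i j).2.
have col (u : rsubset n r) d : (forall i, elt u i = z (d i)) ->
    block_leader L d phi -> t0 phi = Some (f u).
  move=> ud lead; rewrite -(tuple_color_address f lead ud); congr (_ _ phi).
  apply/esym/hom; last by rewrite size_map size_address.
  apply: subseq_map_nth; first by apply: sorted_address => //; apply: lift_lt ud.
  by apply: sub_all (address_bound L d phi) => i /leq_trans; apply.
have := col s a sa leada; rewrite (col t b tb leadb).
by case.
Qed.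

Theorem theorem2p8 (K L r c : nat) :
  exists K' L' : nat,
    forall n : nat, K' * L' <= n ->
    forall E : rel 'I_n, equivalence_rel E ->
    K' <= #|[set C in equivalence_partition E [set: 'I_n] | L' <= #|C|]| ->
    forall f : rsubset n r -> 'I_c,
    exists X : {set 'I_n},
      [/\ E_homogeneous E f X,
          K <= #|equivalence_partition E X| &
          forall C : {set 'I_n}, C \in equivalence_partition E X ->
            convex_in C X /\ L <= #|C|].
Proof.
(* Blocks of size [L.+1] rather than [L]: with [L = 0] the set of chosen points
   would be empty and have no classes at all. *)
pose m := K * L.+1.
pose T := {ffun {ffun 'I_r -> 'I_r} -> option 'I_c}.
have [N HN] := ramsey nat T (r + r) (\sum_(t : T) (m + m)).
exists N.+1, (N.+1 * N.+1) => n Nn E eqE many f.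
have n0 : 0 < n by apply: leq_trans Nn; rewrite !muln_gt0.
have [|C [x [CP Cinj xC xrow xlex]]] :=
  @increasing_blocks n N.+1 (Ordinal n0) N.+1 0 _ many.
  move=> C; rewrite inE => /andP[_ /leq_trans]; apply.
  by apply: subset_leq_card; apply/subsetP => y; rewrite inE andbT.
have [|t0 [h [hN mh hom]]] :=
  HN (fun=> m + m) (leqnn _) (tuple_color x f) (iota 0 N).
  by rewrite size_iota.
have h_lt i j : i < j -> j < m + m -> nth 0 h i < nth 0 h j.
  move=> ij jm; apply: (sorted_ltn_nth ltn_trans) => //; rewrite ?inE.
  - exact: (subseq_sorted ltn_trans hN (iota_ltn_sorted 0 N)).
  - exact: leq_trans (ltn_trans ij jm) mh.
  - exact: leq_trans jm mh.
have h_inj i j : i < m + m -> j < m + m -> nth 0 h i = nth 0 h j -> i = j.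
  move=> im jm eqh; case: (ltngtP i j) => //.
    by move=> ij; have := h_lt i j ij jm; rewrite eqh ltnn.
  by move=> ji; have := h_lt j i ji im; rewrite eqh ltnn.
have h_N i : i < m + m -> nth 0 h i < N.+1.
  move=> im; have /(mem_subseq hN) := mem_nth 0 (leq_trans im mh).
  by rewrite mem_iota => /ltnW.
pose z (a : 'I_m) := x (nth 0 h (a %/ L.+1 * L.+1)) (nth 0 h (m + a)).
have bm (a : 'I_m) : a %/ L.+1 * L.+1 < m + m.
  by have := leq_divM a L.+1; have := ltn_ord a; lia.
have im (a : 'I_m) : m + a < m + m by rewrite ltn_add2l.
have z_lt (a b : 'I_m) : a < b -> z a < z b.
  move=> ab; have := leq_div2r L.+1 (ltnW ab); rewrite leq_eqVlt /z.
  case/orP => [/eqP->|abL]; first by rewrite xrow ?h_N ?h_lt ?ltn_add2l.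
  by rewrite xlex ?h_N ?h_lt ?ltn_pmul2r.
have zC a : z a \in C (nth 0 h (a %/ L.+1 * L.+1)).
  by have /andP[] := xC _ _ (h_N _ (bm a)) (h_N _ (im a)).
have zE a b : E (z a) (z b) = (a %/ L.+1 == b %/ L.+1).
  (* Each [C i] is the full class of any of its members. *)
  have inC i : i < N.+1 -> forall u v, u \in C i -> E u v = (v \in C i).
    move=> /CP; rewrite inE => /andP[/imsetP[w _ ->] _] u v.
    rewrite !inE => wu; apply/esym; exact: (eqE w u v).2.
  rewrite (inC _ (h_N _ (bm a)) _ _ (zC a)).
  have [->|neq] := eqVneq (a %/ L.+1) (b %/ L.+1).
    exact: zC.
  apply: contraNF neq => zbC.
  have eqC : C (nth 0 h (a %/ L.+1 * L.+1)) = C (nth 0 h (b %/ L.+1 * L.+1)).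
    apply/setP => u; rewrite -(inC _ (h_N _ (bm a)) _ _ zbC).
    by rewrite (inC _ (h_N _ (bm b)) _ _ (zC b)).
  have eqh := Cinj _ _ (h_N _ (bm a)) (h_N _ (bm b)) eqC.
  have := h_inj _ _ (bm a) (bm b) eqh.
  by move/eqP; rewrite eqn_pmul2r.
have [X1 X2] := partition_block_image (ltn0Sn L) z_lt zE.
exists [set z a | a : 'I_m]; split=> //.
- exact: homogeneous_of_tuple_color mh hom z_lt zE.
- by move=> D /X2[? /ltnW].
Qed.
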